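(* For a squarefree integer $D$ and a positive integer $d$, let $\mathcal{AP}_{(1,1,1,d)}(\mathbb{Q}(\sqrt{D}))$ be the set of triples $(x,y,z)$ of elements of the ring of integers of $\mathbb{Q}(\sqrt{D})$ with $y-x=z-y$ satisfying $x^2+y^2+z^2=dxyz$, and let $\mathcal{AP}_{(1,1,1,d)}(\mathbb{Q})$ be the analogous set of integer triples. Let $i=\sqrt{-1}$. Then: $\mathcal{AP}_{(1,1,1,1)}(\mathbb{Q}(i))=\{(0,0,0),(3,3,3),(-15,-6,3),(3,-6,-15),(2,\pm2i+2,\pm4i+2),(\pm i+2,2,\mp i+2),(\pm i+2,\pm2i-1,\pm3i-4),(\pm2i-1,-1,\mp2i-1),(\pm4i+2,\pm2i+2,2),(\pm3i-4,\pm2i-1,\pm i+2)\}$ (signs taken consistently within each triple); $\mathcal{AP}_{(1,1,1,2)}(\mathbb{Q}(i))=\{(0,0,0),(\pm2i+1,\pm i+1,1),(1,\pm i+1,\pm2i+1)\}$; and for every squarefree $D<0$ and positive integer $d$ with $(D,d)\neq(-1,1),(-1,2)$, $\mathcal{AP}_{(1,1,1,d)}(\mathbb{Q}(\sqrt{D}))=\mathcal{AP}_{(1,1,1,d)}(\mathbb{Q})$. *)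

(* Defs.v *)
From mathcomp Require Import all_boot all_order all_algebra all_field.
Set Implicit Arguments.
Unset Strict Implicit.
Unset Printing Implicit Defensive.
Import Order.TTheory GRing.Theory Num.Theory.
Local Open Scope ring_scope.

(* In particular 0 is not squarefree. *)
Definition squarefreez (D : int) : Prop :=
  forall m : int, (m ^+ 2 %| D)%Z -> m \is a GRing.unit.

(* Q(sqrt D), realised as a subfield of the algebraic numbers; the choice of
   square root made by sqrtC does not affect this set. *)
Definition in_quad_field (D : int) (x : algC) : Prop :=
  exists a b : rat, x = ratr a + ratr b * sqrtC (D%:~R).

Definition quad_int_ring (D : int) (x : algC) : Prop :=
  in_quad_field D x /\ x \in Aint.

Definition AP_sol (O : algC -> Prop) (d : nat) (t : algC * algC * algC) : Prop :=
  let: (x, y, z) := t in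
  [/\ O x, O y, O z, y - x = z - y
    & x ^+ 2 + y ^+ 2 + z ^+ 2 = d%:R * x * y * z].

Definition AP_quad (D : int) (d : nat) : algC * algC * algC -> Prop :=
  AP_sol (quad_int_ring D) d.

Definition AP_rat (d : nat) : algC * algC * algC -> Prop :=
  AP_sol (fun x => x \in Num.int) d.

(* The argument s stands for one consistent choice of sign in "+/- i", so the
   two signed families are the instances s = 'i and s = - 'i. *)
Definition signed_triples1 (s : algC) : seq (algC * algC * algC) :=
  [:: (2, 2 * s + 2, 4 * s + 2);
      (s + 2, 2, - s + 2);
      (s + 2, 2 * s - 1, 3 * s - 4);
      (2 * s - 1, - 1, - (2 * s) - 1);
      (4 * s + 2, 2 * s + 2, 2);
      (3 * s - 4, 2 * s - 1, s + 2)].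

Definition triples1 : seq (algC * algC * algC) :=
  [:: (0, 0, 0); (3, 3, 3); (- 15, - 6, 3); (3, - 6, - 15)]
  ++ signed_triples1 'i ++ signed_triples1 (- 'i).

Definition signed_triples2 (s : algC) : seq (algC * algC * algC) :=
  [:: (2 * s + 1, s + 1, 1); (1, s + 1, 2 * s + 1)].

Definition triples2 : seq (algC * algC * algC) :=
  (0, 0, 0) :: signed_triples2 'i ++ signed_triples2 (- 'i).

(* Main.v *)
(**
With [k] the common difference and [y] the middle term, the equation reads
[k^2 (d y + 2) = y^2 (d y - 3)].  If [y] is nonzero, put [t = d y + 2] and
[s = t k / y]: then [s^2 = t (t - 5)], so [s] is integral and [u = 2 t - 5 - 2 s],
[v = 2 t - 5 + 2 s] satisfy [u v = 25] and [4 u t = (u + 5)^2].  The norm [n] of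
[u] divides 625, and exchanging [u] and [v] we may take [n <= 25].  The trace
[a] of [u] satisfies [a^2 <= 4 n], and taking norms gives
[16 n N(t) = (n + 5 a + 25)^2]; this leaves ten values of [t], whatever [D] is.
Each of them gives a rational solution, no solution, or a solution with
[d <= 2] whose field contains a square root of -1, which forces [D = -1].
*)
Require Import Defs.
From mathcomp Require Import all_boot all_order all_algebra all_field.
From mathcomp Require Import ring zify.
Import Order.TTheory GRing.Theory Num.Theory.
Local Open Scope ring_scope.

(** * Algebraic integers, divisibility, square roots of -1 *)

Lemma Aint_sqr (x : algC) : x ^+ 2 \in Aint -> x \in Aint.
Proof.
move=> hx; have := hx; rewrite unfold_in => hp.
(* If [p] is the monic integral minimal polynomial of [x ^+ 2], then p(X^2) is monic, integral and
   vanishes at [x]. *)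
apply: (@root_monic_Aint (minCpoly (x ^+ 2) \Po 'X^2)).
- by rewrite /root horner_comp hornerXn; apply: root_minCpoly.
- apply/eqP; rewrite lead_coef_comp ?size_polyXn //.
  by rewrite (eqP (minCpoly_monic _)) lead_coefXn expr1n mul1r.
- by apply: polyOver_comp => //; rewrite rpredX ?polyOverX.
Qed.

(** A rational algebraic integer is an integer. The later contradictions by divisibility in the
    integers all pass through this form. *)
Lemma Aint_dvdz (x : algC) (a b : int) :
  x \in Aint -> b != 0 -> b%:~R * x = a%:~R -> (b %| a)%Z.
Proof.
move=> hx hb e.
have hb' : (b%:~R : algC) != 0 by rewrite intr_eq0.
have xE : x = a%:~R / b%:~R by rewrite -e mulrC mulKf.
have : x \in Crat by rewrite xE rpred_div // rpred_int.
move=> /Cint_rat_Aint/(_ hx)/intrP[m xm].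
apply/dvdzP; exists m; apply: (@intr_inj algC).
by rewrite -e xm -intrM mulrC.
Qed.

Lemma conj_sqrtN1 (e : algC) : e ^+ 2 = -1 -> e^* = - e.
Proof.
move=> e2; have : e^* ^+ 2 == e ^+ 2 by rewrite -rmorphXn /= e2 rmorphN rmorph1.
rewrite eqf_sqr => /orP[/eqP h|/eqP //].
(* A self-conjugate [e] would make [e ^+ 2 = -1] nonnegative. *)
by have := mul_conjC_ge0 e; rewrite h -expr2 e2 ler0N1.
Qed.

(** * Arithmetic of an imaginary quadratic field: conjugation, trace, norm *)

Section QuadField.

Variable D : int.

Lemma quad_field_rat (q : algC) : q \in Crat -> in_quad_field D q.
Proof. by case/CratP=> a ->; exists a, 0; rewrite rmorph0 mul0r addr0. Qed.

Lemma quad_fieldD (x y : algC) :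
  in_quad_field D x -> in_quad_field D y -> in_quad_field D (x + y).
Proof.
move=> [a [b ->]] [a' [b' ->]]; exists (a + a'), (b + b').
by rewrite !rmorphD /=; ring.
Qed.

Lemma quad_fieldM (x y : algC) :
  in_quad_field D x -> in_quad_field D y -> in_quad_field D (x * y).
Proof.
move=> [a [b ->]] [a' [b' ->]].
exists (a * a' + b * b' * D%:~R), (a * b' + a' * b).
have h := sqrtCK (D%:~R : algC).
by rewrite !rmorphD /= !rmorphM /= ratr_int; ring: h.
Qed.

Lemma quad_fieldN (x : algC) : in_quad_field D x -> in_quad_field D (- x).
Proof.
move=> hx; rewrite -mulN1r; apply: quad_fieldM => //.
by apply: quad_field_rat; rewrite rpredN rpred1.
Qed.

Hypothesis D_lt0 : D < 0.

Lemma conj_sqrtC_neg : (sqrtC (D%:~R : algC))^* = - sqrtC D%:~R.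
Proof.
set r := sqrtC _.
have r2 : r ^+ 2 = D%:~R by apply: sqrtCK.
have : r^* ^+ 2 == r ^+ 2 by rewrite -rmorphXn /= r2 rmorph_int.
rewrite eqf_sqr => /orP[/eqP h|/eqP //].
have := mul_conjC_ge0 r; rewrite h -expr2 r2 ler0z.
by rewrite leNgt D_lt0.
Qed.

Lemma conj_quad (a b : rat) :
  (ratr a + ratr b * sqrtC D%:~R : algC)^* = ratr a - ratr b * sqrtC D%:~R.
Proof.
move: (conj_Crat (Crat_rat a)) (conj_Crat (Crat_rat b)) => /=.
move: (ratr a : algC) (ratr b : algC) => A B hA hB.
by rewrite rmorphD rmorphM /= conj_sqrtC_neg hA hB mulrN.
Qed.

Lemma quad_field_conj (x : algC) : in_quad_field D x -> in_quad_field D x^*.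
Proof.
move=> [a [b ->]]; exists a, (- b).
by rewrite conj_quad [ratr (- b)]rmorphN mulNr.
Qed.

Lemma quad_field_tr (x : algC) : in_quad_field D x -> x + x^* \in Crat.
Proof.
move=> [a [b ->]]; rewrite conj_quad addrACA subrr addr0.
by rewrite rpredD ?Crat_rat.
Qed.

Lemma quad_field_norm (x : algC) : in_quad_field D x -> x * x^* \in Crat.
Proof.
move=> [a [b ->]]; rewrite conj_quad.
set A : algC := ratr a; set B : algC := ratr b; set r := sqrtC _.
have -> : (A + B * r) * (A - B * r) = A ^+ 2 - B ^+ 2 * r ^+ 2 by ring.
have hD : (D%:~R : algC) \in Crat by apply: rpred_int.
have hA : A \in Crat by apply: Crat_rat.
have hB : B \in Crat by apply: Crat_rat.
by rewrite sqrtCK; apply: rpredB; [apply: rpredX|apply: rpredM => //; apply: rpredX].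
Qed.

(** The inverse is the conjugate divided by the norm, and the norm is rational. *)
Lemma quad_fieldV (x : algC) : in_quad_field D x -> in_quad_field D x^-1.
Proof.
move=> hx; rewrite invC_norm; apply: quad_fieldM; last exact: quad_field_conj.
by apply: quad_field_rat; rewrite rpredV normCK quad_field_norm.
Qed.

Lemma quad_int_tr (x : algC) : quad_int_ring D x -> x + x^* \in Num.int.
Proof.
case=> hx xA; apply: Cint_rat_Aint; first exact: quad_field_tr.
by rewrite rpredD // Aint_aut.
Qed.

Lemma quad_int_norm (x : algC) : quad_int_ring D x -> x * x^* \in Num.int.
Proof.
case=> hx xA; apply: Cint_rat_Aint; first exact: quad_field_norm.
by rewrite rpredM // Aint_aut.
Qed.

(** Conjugation negates [e], which kills its rational part, so e = b sqrt(D) and b^2 D = -1. Then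
    1/b is rational with integral square -D, hence an integer [m]; since m^2 divides the squarefree
    [D], m^2 = 1. *)
Lemma quad_field_i (e : algC) :
  squarefreez D -> in_quad_field D e -> e ^+ 2 = -1 -> D = -1.
Proof.
move=> sqfD he e2.
have ec := conj_sqrtN1 _ e2.
case: he => a [b eE].
have a0 : (ratr a : algC) = 0.
  have := ec; rewrite eE conj_quad opprD => /addIr/esym/eqP.
  by rewrite eqNr => /eqP.
move: eE; rewrite a0 add0r => eE.
have bD : (ratr b : algC) ^+ 2 * D%:~R = -1.
  by rewrite -[D%:~R]sqrtCK -exprMn -eE.
have bN0 : (ratr b : algC) != 0.
  by apply: contra_eq_neq bD => ->; rewrite expr0n mul0r eq_sym oppr_eq0 oner_eq0.
have DE : ((ratr b)^-1 : algC) ^+ 2 = (- D)%:~R.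
  rewrite rmorphN /=; apply: (@mulfI _ ((ratr b : algC) ^+ 2)).
    by rewrite expf_neq0.
  by rewrite mulrN bD -exprMn mulfV // expr1n opprK.
have /intrP[m mE] : (ratr b : algC)^-1 \in Num.int.
  apply: Cint_rat_Aint; first by rewrite rpredV Crat_rat.
  by apply: Aint_sqr; rewrite DE rpred_int.
have mD : m ^+ 2 = - D by apply: (@intr_inj algC); rewrite rmorphXn /= -mE.
have : m \is a GRing.unit by apply: sqfD; apply/dvdzP; exists (-1); rewrite mD; ring.
by case/orP=> /eqP m1; move: mD; rewrite m1; lia.
Qed.

End QuadField.

Lemma quad_intD (D : int) (x y : algC) :
  quad_int_ring D x -> quad_int_ring D y -> quad_int_ring D (x + y).
Proof. by move=> [? ?] [? ?]; split; [apply: quad_fieldD|apply: rpredD]. Qed.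

Lemma quad_intM (D : int) (x y : algC) :
  quad_int_ring D x -> quad_int_ring D y -> quad_int_ring D (x * y).
Proof. by move=> [? ?] [? ?]; split; [apply: quad_fieldM|apply: rpredM]. Qed.

Lemma quad_int_int (D : int) (x : algC) : x \in Num.int -> quad_int_ring D x.
Proof.
case/intrP=> m ->; split; last exact: rpred_int.
by apply: quad_field_rat; apply: rpred_int.
Qed.

Lemma quad_intN (D : int) (x : algC) : quad_int_ring D x -> quad_int_ring D (- x).
Proof.
move=> hx; rewrite -mulN1r; apply: quad_intM => //.
by apply: quad_int_int; rewrite rpredN rpred1.
Qed.

(** * The ten possible values of t *)

Lemma trace_norm_enum (n a M : int) :
  (n == 1) || (n == 5) || (n == 25) -> a ^+ 2 <= 4 * n ->
  16 * n * M = (n + 5 * a + 25) ^+ 2 ->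
  (n, a) \in [:: (1, 2); (1, -2); (5, 2); (5, -2); (25, 2); (25, -2);
                 (25, 6); (25, -6); (25, 10); (25, -10)].
Proof.
move=> hn ha hM.
have a_bound : -10 <= a <= 10.
  by case/orP: hn => [/orP[]|] /eqP hn; rewrite hn in ha; nia.
(* The shift by 10 turns the range of [a] into a list of naturals to run through. The survivors are
   the [a] congruent to 2 mod 4: the square is divisible by 16, so 4 divides n + 5a + 25, and [n] is
   1 mod 4. *)
have [m m20 aE] : exists2 m : nat, (m < 21)%N & a = m%:Z - 10.
  by exists (absz (a + 10)); lia.
have m_iota : m \in iota 0 21 by rewrite mem_iota.
move: hn ha hM; rewrite {}aE => {m20 a_bound}.
case/orP=> [/orP[]|] /eqP -> ha hM; move: m_iota ha hM; rewrite /= !inE;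
  repeat (case/orP); move/eqP=> -> ha hM; try by []; exfalso; lia.
Qed.

(** Since [u] is a root of X^2 - aX + n, each of the ten pairs [(n, a)] turns the relation between
    [u] and [t] into an explicit [t]. The root [e] is read off from [u] when n = 5; elsewhere [t] is
    rational and 'i is taken. *)
Lemma factor_cases (D : int) (u t : algC) :
  D < 0 -> quad_int_ring D u -> quad_int_ring D t ->
  (u * u^* == 1) || (u * u^* == 5) || (u * u^* == 25) ->
  4 * u * t = (u + 5) ^+ 2 ->
  exists2 e : algC, e ^+ 2 = -1 &
    t \in [:: 9; -4; 5; 0; 3; 2; 4; 1; 4 - 2 * e; 1 - 2 * e].
Proof.
move=> D0 uq tq hn ut.
have /intrP[n nE] := quad_int_norm _ D0 _ uq.
have /intrP[a aE] := quad_int_tr _ D0 _ uq.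
have /intrP[M ME] := quad_int_norm _ D0 _ tq.
have ut' : 4 * u^* * t^* = (u^* + 5) ^+ 2.
  by have := congr1 Num.conj ut; rewrite rmorphXn rmorphD !rmorphM /= !rmorph_nat.
have hM : 16 * n * M = (n + 5 * a + 25) ^+ 2.
  apply: (@intr_inj algC).
  rewrite rmorphXn /= !rmorphD !rmorphM /= -nE -aE -ME.
  transitivity ((u + 5) ^+ 2 * (u^* + 5) ^+ 2); last by ring.
  by rewrite -ut -ut'; ring.
(* The difference 4n - a^2 is the squared modulus of [u] minus its conjugate. *)
have ha : a ^+ 2 <= 4 * n.
  rewrite -subr_ge0 -(ler0z algC) rmorphB rmorphXn rmorphM /= -nE -aE.
  have := mul_conjC_ge0 (u - u^*); rewrite rmorphB /= conjCK.
  by congr (_ <= _); ring.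
have hn' : (n == 1) || (n == 5) || (n == 25).
  by rewrite -!(eqr_int algC) -nE.
have u2 : u ^+ 2 = a%:~R * u - n%:~R by rewrite -nE -aE; ring.
have uN0 : u != 0.
  apply: contraTneq hn => ->.
  by rewrite mul0r !(eq_sym 0) oner_eq0 !pnatr_eq0.
have := trace_norm_enum _ _ _ hn' ha hM.
have i2 : 'i ^+ 2 = -1 :> algC by rewrite sqrCi.
(* Here (u + 5)^2 = u^2 + 10u + 25 = (a + 10) u, and [u] cancels. *)
have t25 : n = 25 -> 4 * t = a%:~R + 10.
  move=> n25; apply: (mulfI uN0).
  by rewrite n25 in u2; transitivity (4 * u * t); [ring|rewrite ut; ring: u2].
have four0 : (4 : algC) != 0 by rewrite pnatr_eq0.
have two0 : (2 : algC) != 0 by rewrite pnatr_eq0.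
have rat_t (a' : int) (c : algC) : a = a' -> n = 25 -> a'%:~R + 10 = 4 * c -> t = c.
  by move=> aa n25 h; apply: (mulfI four0); rewrite -h -aa t25.
rewrite !inE; repeat case/orP; rewrite xpair_eqE => /andP[/eqP n0 /eqP a0].
- exists 'i => //; have u1 : u = 1.
    apply/eqP; rewrite -subr_eq0 -sqrf_eq0 sqrrB u2 a0 n0; apply/eqP; ring.
  have -> : t = 9 by apply: (mulfI four0); move: ut; rewrite u1 mulr1 => ->; ring.
  by rewrite !inE eqxx ?orbT.
- exists 'i => //; have u1 : u = -1.
    apply/eqP; rewrite -subr_eq0 -sqrf_eq0 sqrrB u2 a0 n0; apply/eqP; ring.
  have -> : t = -4.
    apply: (mulfI four0); move: ut; rewrite u1 mulrN1 mulNr => /eqP.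
    by rewrite eqr_oppLR => /eqP ->; ring.
  by rewrite !inE eqxx ?orbT.
(* For n = 5 and a = 2, (u - 1)^2 = -4; for a = -2 below, (u + 1)^2 = -4. *)
- exists ((u - 1) / 2).
    have -> : ((u - 1) / 2) ^+ 2 = (u ^+ 2 - 2 * u + 1) / 4 by field.
    by rewrite u2 a0 n0; field.
  have -> : t = 4 - 2 * ((u - 1) / 2).
    apply: (mulfI uN0); apply: (mulfI four0); rewrite mulrA ut a0 n0 in u2 *.
    have -> : 4 * (u * (4 - 2 * ((u - 1) / 2))) = 20 * u - 4 * u ^+ 2 by field.
    by ring: u2.
  by rewrite !inE eqxx ?orbT.
- exists ((u + 1) / 2).
    have -> : ((u + 1) / 2) ^+ 2 = (u ^+ 2 + 2 * u + 1) / 4 by field.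
    by rewrite u2 a0 n0; field.
  have -> : t = 1 - 2 * ((u + 1) / 2).
    apply: (mulfI uN0); apply: (mulfI four0); rewrite mulrA ut a0 n0 in u2 *.
    have -> : 4 * (u * (1 - 2 * ((u + 1) / 2))) = - 4 * u ^+ 2 by field.
    by ring: u2.
  by rewrite !inE eqxx ?orbT.
- by exists 'i => //; rewrite (rat_t 2 3 a0 n0) ?inE ?eqxx ?orbT //; ring.
- by exists 'i => //; rewrite (rat_t (-2) 2 a0 n0) ?inE ?eqxx ?orbT //; ring.
- by exists 'i => //; rewrite (rat_t 6 4 a0 n0) ?inE ?eqxx ?orbT //; ring.
- by exists 'i => //; rewrite (rat_t (-6) 1 a0 n0) ?inE ?eqxx ?orbT //; ring.
- by exists 'i => //; rewrite (rat_t 10 5 a0 n0) ?inE ?eqxx ?orbT //; ring.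
- by exists 'i => //; rewrite (rat_t (-10) 0 a0 n0) ?inE ?eqxx ?orbT //; ring.
Qed.

Lemma divisor_625_le25 (p q : nat) :
  (p * q = 625)%N -> (p <= 25)%N -> [|| p == 1, p == 5 | p == 25]%N.
Proof.
move=> pq p25; have p_iota : p \in iota 0 26 by rewrite mem_iota.
move: p_iota pq; rewrite /= !inE.
by repeat case/orP; move/eqP=> -> pq; try by []; exfalso; lia.
Qed.

Lemma AP_cases (D : int) (d : nat) (y k : algC) :
  D < 0 -> quad_int_ring D y -> quad_int_ring D k -> y != 0 ->
  k ^+ 2 * (d%:R * y + 2) = y ^+ 2 * (d%:R * y - 3) ->
  exists2 e : algC, e ^+ 2 = -1 &
    d%:R * y + 2 \in [:: 9; -4; 5; 0; 3; 2; 4; 1; 4 - 2 * e; 1 - 2 * e].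
Proof.
move=> D0 yq kq y0 eqn; set t := _ + 2 in eqn *.
have natq m : quad_int_ring D m%:R by apply: quad_int_int; apply: rpred_nat.
have tq : quad_int_ring D t by apply: quad_intD => //; apply: quad_intM.
pose s := t * k / y.
have s2 : s ^+ 2 = t * (t - 5).
  have -> : s ^+ 2 = t * (k ^+ 2 * t) / y ^+ 2 by rewrite /s; field.
  by rewrite eqn /t; field.
have sq : quad_int_ring D s.
  split.
    apply: quad_fieldM; first by case: (quad_intM _ _ _ tq kq).
    by apply: quad_fieldV => //; case: yq.
  apply: Aint_sqr; rewrite s2.
  by case: tq => _ tA; apply: rpredM => //; apply: rpredB => //; apply: rpred_nat.
pose u := 2 * t - 5 - 2 * s; pose v := 2 * t - 5 + 2 * s.
have uq : quad_int_ring D u.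
  apply: quad_intD; last by apply: quad_intN; apply: quad_intM.
  by apply: quad_intD; [apply: quad_intM|apply: quad_intN].
have vq : quad_int_ring D v.
  apply: quad_intD; last exact: quad_intM.
  by apply: quad_intD; [apply: quad_intM|apply: quad_intN].
have uv : u * v = 25 by rewrite /u /v; ring: s2.
have ut : 4 * u * t = (u + 5) ^+ 2 by rewrite /u; ring: s2.
have vt : 4 * v * t = (v + 5) ^+ 2 by rewrite /v; ring: s2.
have norm_nat w : quad_int_ring D w -> exists n : nat, w * w^* = n%:R.
  move=> wq; apply/natrP; rewrite natrEint mul_conjC_ge0 andbT.
  exact: quad_int_norm wq.
have [m mE] := norm_nat _ uq; have [n nE] := norm_nat _ vq.
have mn : (m * n = 625)%N.
  apply: (@mulrIn algC 1); first exact: oner_neq0.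
  rewrite natrM -mE -nE mulrACA -rmorphM uv rmorph_nat.
  by ring.
(* Both [u] and [v] satisfy the relation required by [factor_cases], so it applies to whichever has
   norm at most 25. *)
have [m25|n25] : (m <= 25)%N \/ (n <= 25)%N by nia.
- apply: (factor_cases D u) => //; rewrite mE -orbA !eqr_nat pnatr_eq1.
  exact: (divisor_625_le25 m n mn).
- apply: (factor_cases D v) => //; rewrite nE -orbA !eqr_nat pnatr_eq1.
  by apply: (divisor_625_le25 n m); rewrite 1?mulnC.
Qed.

(** * From t back to y, k, d and D *)

Lemma dvd_norm_lt9_le2 (d N : nat) (y w w' : algC) :
  y \in Aint -> (0 < d)%N -> (0 < N < 9)%N ->
  d%:R * y = w -> w^* = w' -> w * w' = N%:R -> (d <= 2)%N.
Proof.
move=> yA d0 N9 dy <-; rewrite -{}dy rmorphM rmorph_nat /= => h.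
(* Taking norms in [d y = w], d^2 times the algebraic integer [y * y^*] equals [N], which is below
   9. *)
have hd : ((d ^ 2)%N%:Z %| N%:Z)%Z.
  apply: (@Aint_dvdz (y * y^*)); first by rewrite rpredM // Aint_aut.
    by rewrite -lt0n expn_gt0 d0.
  by rewrite -[RHS]h -[_%:~R]/((d ^ 2)%:R) natrX; ring.
have : (d ^ 2 <= N)%N by apply: dvdn_leq => //; lia.
nia.
Qed.

Lemma AP_diff0 (d : nat) (y k : algC) :
  k ^+ 2 * (d%:R * y + 2) = y ^+ 2 * (d%:R * y - 3) -> y = 0 -> k = 0.
Proof.
move=> eqn y0; move: eqn; rewrite y0 mulr0 add0r expr0n mul0r => /eqP.
by rewrite mulf_eq0 sqrf_eq0 pnatr_eq0 orbF => /eqP.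
Qed.

(** The equation reads (k/y)^2 = (t - 5)/t when t is nonzero. For t = 9, -4, 5 the right side is the
    square of 2/3, 3/2, 0, so [y] and [k] are rational. For t = 4, 1 it is -1/4, -4, and for the two
    nonrational values [t] itself yields [e]: in these four cases the field contains a square root
    of -1. The values 0, 3, 2 are impossible. *)
Lemma AP_rat_or_gauss (D : int) (d : nat) (y k : algC) :
  squarefreez D -> D < 0 -> (0 < d)%N -> quad_int_ring D y -> quad_int_ring D k ->
  k ^+ 2 * (d%:R * y + 2) = y ^+ 2 * (d%:R * y - 3) ->
  (y \in Num.int /\ k \in Num.int) \/ (D = -1 /\ (d <= 2)%N).
Proof.
move=> sqfD D0 d0 yq kq eqn.
have [y0|yN0] := eqVneq y 0.
  by left; rewrite (AP_diff0 _ _ _ eqn y0) y0 rpred0.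
have [yK yA] := yq; have [kK kA] := kq.
have dN0 : (d%:R : algC) != 0 by rewrite pnatr_eq0 -lt0n.
have natK m : in_quad_field D m%:R by apply: quad_field_rat; apply: rpred_nat.
have [e e2] := AP_cases _ _ _ _ D0 yq kq yN0 eqn.
have ec := conj_sqrtN1 _ e2.
have tE t : d%:R * y + 2 = t -> d%:R * y = t - 2 /\ k ^+ 2 * t = y ^+ 2 * (t - 5).
  by move=> <-; split; [ring|rewrite eqn; ring].
have rat_case t c : d%:R * y + 2 = t -> t \in Crat -> c \in Crat -> t != 0 ->
    c ^+ 2 * t = t - 5 -> y \in Num.int /\ k \in Num.int.
  move=> /tE[dy kt] tQ cQ tN0 ct.
  have yQ : y \in Crat.
    have -> : y = (t - 2) / d%:R by rewrite -dy mulrC mulKf.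
    by apply: rpred_div; [apply: rpredB => //|]; apply: rpred_nat.
  have : k ^+ 2 == (c * y) ^+ 2.
    by apply/eqP; apply: (mulIf tN0); rewrite kt -ct; ring.
  rewrite eqf_sqr => kcy.
  have kQ : k \in Crat.
    by case/orP: kcy => /eqP ->; rewrite ?rpredN; apply: rpredM.
  by split; apply: Cint_rat_Aint.
have gauss f : in_quad_field D f -> f ^+ 2 = -1 -> D = -1.
  exact: quad_field_i.
have d_dvd (m : int) : d%:R * y = m%:~R -> (d%:Z %| m)%Z.
  by move=> h; apply: (@Aint_dvdz y) => //; rewrite -lt0n.
rewrite !inE; repeat case/orP; move=> /eqP tv; have [dy kt] := tE _ tv.
- left; apply: (rat_case _ (2 / 3) tv); rewrite ?pnatr_eq0 ?rpred_div ?rpred_nat //.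
  by field.
- left; apply: (rat_case _ (3 / 2) tv);
    rewrite ?oppr_eq0 ?pnatr_eq0 ?rpredN ?rpred_div ?rpred_nat //.
  by field.
- by left; apply: (rat_case _ 0 tv); rewrite ?pnatr_eq0 ?rpred0 ?rpred_nat //; ring.
- exfalso; move: kt; rewrite mulr0 => /esym/eqP.
  by rewrite mulf_eq0 sqrf_eq0 (negPf yN0) sub0r oppr_eq0 pnatr_eq0.
(* For t = 3, [d y = 1] forces d = y = 1, and then 3 k^2 = -2. *)
- exfalso; have d1 : d = 1%N.
    by have /d_dvd : d%:R * y = 1%:~R; [rewrite dy; ring|rewrite dvdz1 => /eqP].
  have y1 : y = 1 by move: dy; rewrite d1 mul1r => ->; ring.
  have : (3 %| - 2)%Z.
    apply: (@Aint_dvdz (k ^+ 2)); rewrite ?rpredX // mulrC.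
    by transitivity (k ^+ 2 * 3) => //; rewrite kt y1; ring.
  by [].
- exfalso; move: dy; rewrite subrr => /eqP.
  by rewrite mulf_eq0 (negPf dN0) (negPf yN0).
(* For t = 4, k^2 = -y^2/4, and [d y = 2] makes [d] a divisor of 2. *)
- right; split.
    apply: (gauss (2 * k / y)).
      by apply: quad_fieldM; [apply: quad_fieldM|apply: quad_fieldV].
    have -> : (2 * k / y) ^+ 2 = (k ^+ 2 * 4) / y ^+ 2 by field.
    by rewrite kt; field.
  by have /d_dvd/dvdn_leq : d%:R * y = 2%:~R; [rewrite dy; ring|apply].
- right; split.
    apply: (gauss (k / (2 * y))).
      by apply: quad_fieldM => //; apply: quad_fieldV => //; apply: quad_fieldM.
    have -> : (k / (2 * y)) ^+ 2 = (k ^+ 2 * 1) / (4 * y ^+ 2) by field.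
    by rewrite kt; field.
  have /d_dvd/dvdn_leq : d%:R * y = (-1)%:~R by rewrite dy; ring.
  by move=> /(_ isT)/leq_trans; apply.
(* For t = 4 - 2e, [d y = 2 - 2e] has norm 8; in the next case [d y = -1 - 2e] has norm 5. *)
- right; split.
    apply: (gauss e) => //.
    have -> : e = (2 - d%:R * y) / 2 by rewrite dy; field.
    apply: quad_fieldM; last exact: quad_fieldV.
    by apply: quad_fieldD => //; apply: quad_fieldN; apply: quad_fieldM.
  apply: (@dvd_norm_lt9_le2 d 8 y _ (2 + 2 * e) yA d0 isT dy).
    by rewrite !rmorphB /= rmorphM /= ec !rmorph_nat; ring.
  by ring: e2.
- right; split.
    apply: (gauss e) => //.
    have -> : e = (- 1%:R - d%:R * y) / 2 by rewrite dy; field.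
    apply: quad_fieldM; last exact: quad_fieldV.
    by apply: quad_fieldD; apply: quad_fieldN => //; apply: quad_fieldM.
  apply: (@dvd_norm_lt9_le2 d 5 y _ (-1 + 2 * e) yA d0 isT dy).
    by rewrite !rmorphB /= rmorphM /= ec !rmorph_nat rmorph1; ring.
  by ring: e2.
Qed.

(** * Passing to the middle term and the common difference *)

Lemma AP_equation_diff (d : nat) (y k : algC) :
  (y - k) ^+ 2 + y ^+ 2 + (y + k) ^+ 2 = d%:R * (y - k) * y * (y + k) ->
  k ^+ 2 * (d%:R * y + 2) = y ^+ 2 * (d%:R * y - 3).
Proof.
move=> h; apply/eqP; rewrite -subr_eq0; move/eqP: h; rewrite -subr_eq0.
by congr (_ == _); ring.
Qed.

(** As [O] is an arbitrary predicate, membership of [k] is carried as [O (y - k)]; [quad_int_diff]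
    recovers it for quadratic integers. *)
Lemma AP_sol_diff (O : algC -> Prop) (d : nat) (x y z : algC) :
  AP_sol O d (x, y, z) ->
  exists k, [/\ x = y - k, z = y + k, O y, O (y - k)
              & k ^+ 2 * (d%:R * y + 2) = y ^+ 2 * (d%:R * y - 3)].
Proof.
case=> hx hy _ xyz eqn; exists (y - x).
have zE : z = y + (y - x) by rewrite xyz; ring.
have xE : x = y - (y - x) by ring.
split=> //; first by rewrite -xE.
by apply: AP_equation_diff; rewrite -xE -zE.
Qed.

Lemma quad_int_diff (D : int) (y k : algC) :
  quad_int_ring D y -> quad_int_ring D (y - k) -> quad_int_ring D k.
Proof.
move=> hy hyk; have -> : k = y - (y - k) by ring.
by apply: quad_intD => //; apply: quad_intN.
Qed.

(** * Gaussian integers: the cases d = 1 and d = 2 *)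

Lemma Aint_sqrtN1 (e : algC) : e ^+ 2 = -1 -> e \in Aint.
Proof. by move=> e2; apply: Aint_sqr; rewrite e2 rpredN rpred1. Qed.

Lemma sqrtN1_cases (e : algC) : e ^+ 2 = -1 -> e = 'i \/ e = - 'i.
Proof.
move=> e2; have : e ^+ 2 == 'i ^+ 2 by rewrite e2 sqrCi.
by rewrite eqf_sqr => /orP[] /eqP ->; [left|right].
Qed.

Lemma quad_int_i : quad_int_ring (-1) 'i.
Proof.
split; last by apply: Aint_sqrtN1; rewrite sqrCi.
exists 0, 1; rewrite rmorph0 rmorph1 add0r mul1r imaginaryCE.
by congr sqrtC; rewrite rmorphN rmorph1.
Qed.

(** Now y = t - 2, and [t] fixes k^2, so [k] is known up to sign; the two signs give a triple and
    its reversal. The list is phrased with the root [e] supplied by [AP_cases], whose sign is not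
    controlled. *)
Lemma gauss_AP1 (y k : algC) :
  quad_int_ring (-1) y -> quad_int_ring (-1) k -> y != 0 ->
  k ^+ 2 * (1%:R * y + 2) = y ^+ 2 * (1%:R * y - 3) ->
  exists2 e : algC, e ^+ 2 = -1 &
    (y - k, y, y + k) \in [:: (3, 3, 3); (- 15, - 6, 3); (3, - 6, - 15)]
                          ++ signed_triples1 e ++ signed_triples1 (- e).
Proof.
move=> yq kq yN0 eqn.
have [e e2 tv] := @AP_cases (-1) _ _ _ isT yq kq yN0 eqn; exists e => //.
have tE t : 1%:R * y + 2 = t -> y = t - 2 /\ k ^+ 2 * t = y ^+ 2 * (t - 5).
  by move=> <-; split; [ring|rewrite eqn; ring].
have kA : k ^+ 2 \in Aint by rewrite rpredX //; case: kq.
have sqrt_k t c : t != 0 -> k ^+ 2 * t = y ^+ 2 * (t - 5) ->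
    c ^+ 2 * t = y ^+ 2 * (t - 5) -> k = c \/ k = - c.
  move=> tN0 kt ct; have : k ^+ 2 == c ^+ 2.
    by apply/eqP; apply: (mulIf tN0); rewrite kt.
  by rewrite eqf_sqr => /orP[] /eqP ->; [left|right].
(* Positions 0 to 2 hold the rational triples, 3 to 8 the family of [e], and 9 to 14 that of
   [- e]. *)
have nth_i i (p : algC * algC * algC) s : (i < size s)%N -> p = nth 0 s i -> p \in s.
  by move=> hi ->; apply: mem_nth.
rewrite !inE in tv; move: tv; repeat case/orP; move=> /eqP /tE[yE kt].
(* For t = 9, y = 7 and 9 k^2 = 49 * 4. *)
- exfalso; suff : (9 %| 196)%Z by [].
  apply: (@Aint_dvdz (k ^+ 2)) => //; rewrite mulrC.
  by transitivity (k ^+ 2 * 9) => //; rewrite kt yE; ring.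
- have [] := sqrt_k (-4) 9 _ kt; rewrite ?oppr_eq0 ?pnatr_eq0 //.
  + by rewrite yE; ring.
  + by move=> ->; apply: (nth_i 1%N) => //=; rewrite yE; congr (_, _, _); ring.
  + by move=> ->; apply: (nth_i 2%N) => //=; rewrite yE; congr (_, _, _); ring.
- have [] := sqrt_k 5 0 _ kt; rewrite ?pnatr_eq0 //.
  + by rewrite yE; ring.
  + by move=> ->; apply: (nth_i 0%N) => //=; rewrite yE; congr (_, _, _); ring.
  + by move=> ->; apply: (nth_i 0%N) => //=; rewrite yE; congr (_, _, _); ring.
- exfalso; move: kt; rewrite mulr0 => /esym/eqP.
  by rewrite mulf_eq0 sqrf_eq0 (negPf yN0) sub0r oppr_eq0 pnatr_eq0.
- exfalso; suff : (3 %| - 2)%Z by [].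
  apply: (@Aint_dvdz (k ^+ 2)) => //; rewrite mulrC.
  by transitivity (k ^+ 2 * 3) => //; rewrite kt yE; ring.
- by exfalso; move: yN0; rewrite yE subrr eqxx.
- have [] := sqrt_k 4 e _ kt; rewrite ?pnatr_eq0 //.
  + by rewrite yE; ring: e2.
  + by move=> ->; apply: (nth_i 10%N) => //=; rewrite yE; congr (_, _, _); ring.
  + by move=> ->; apply: (nth_i 4%N) => //=; rewrite yE; congr (_, _, _); ring.
- have [] := sqrt_k 1 (2 * e) _ kt; rewrite ?oner_eq0 //.
  + by rewrite yE; ring: e2.
  + by move=> ->; apply: (nth_i 12%N) => //=; rewrite yE; congr (_, _, _); ring.
  + by move=> ->; apply: (nth_i 6%N) => //=; rewrite yE; congr (_, _, _); ring.
- have tN0 : 4 - 2 * e != 0.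
    apply/eqP => h; have /eqP : (4 - 2 * e) * (4 + 2 * e) = 20 by ring: e2.
    by rewrite h mul0r eq_sym pnatr_eq0.
  have [] := sqrt_k _ (2 * e) tN0 kt.
  + by rewrite yE; ring: e2.
  + by move=> ->; apply: (nth_i 13%N) => //=; rewrite yE; congr (_, _, _); ring.
  + by move=> ->; apply: (nth_i 9%N) => //=; rewrite yE; congr (_, _, _); ring.
- have tN0 : 1 - 2 * e != 0.
    apply/eqP => h; have /eqP : (1 - 2 * e) * (1 + 2 * e) = 5 by ring: e2.
    by rewrite h mul0r eq_sym pnatr_eq0.
  (* Here y = -1 - 2e and (t - 5)/t = -2e, so k^2 = 8 + 6e = (3 + e)^2. *)
  have [] := sqrt_k _ (3 + e) tN0 kt.
  + by rewrite yE; ring: e2.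
  + by move=> ->; apply: (nth_i 14%N) => //=; rewrite yE; congr (_, _, _); ring.
  + by move=> ->; apply: (nth_i 11%N) => //=; rewrite yE; congr (_, _, _); ring.
Qed.

(** Now 2y = t - 2. Parity of 2y excludes the odd rational t; t = -4 and t = 4 give 4 k^2 = 81 and 4
    k^2 = -1. Only t = 4 - 2e survives, with y = 1 - e and k^2 = -1. *)
Lemma gauss_AP2 (y k : algC) :
  quad_int_ring (-1) y -> quad_int_ring (-1) k -> y != 0 ->
  k ^+ 2 * (2%:R * y + 2) = y ^+ 2 * (2%:R * y - 3) ->
  exists2 e : algC, e ^+ 2 = -1 &
    (y - k, y, y + k) \in signed_triples2 e ++ signed_triples2 (- e).
Proof.
move=> yq kq yN0 eqn.
have [e e2 tv] := @AP_cases (-1) _ _ _ isT yq kq yN0 eqn; exists e => //.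
have tE t : 2%:R * y + 2 = t -> 2 * y = t - 2 /\ k ^+ 2 * t = y ^+ 2 * (t - 5).
  by move=> <-; split; [ring|rewrite eqn; ring].
have [_ yA] := yq; have kA : k ^+ 2 \in Aint by rewrite rpredX //; case: kq.
have eA := Aint_sqrtN1 _ e2.
have two0 : (2 : algC) != 0 by rewrite pnatr_eq0.
have odd_y (m : int) w : w \in Aint -> 2 * w = m%:~R -> (2 %| m)%Z.
  by move=> wA h; apply: (@Aint_dvdz w).
rewrite !inE in tv; move: tv; repeat case/orP; move=> /eqP /tE[yE kt].
- by exfalso; suff : (2 %| 7)%Z by []; apply: (odd_y _ y) => //; rewrite yE; ring.
- have y3 : y = -3 by apply: (mulfI two0); rewrite yE; ring.
  exfalso; suff : (4 %| 81)%Z by [].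
  apply: (@Aint_dvdz (k ^+ 2)) => //.
  by transitivity (- (k ^+ 2 * -4)); [ring|rewrite kt y3; ring].
- by exfalso; suff : (2 %| 3)%Z by []; apply: (odd_y _ y) => //; rewrite yE; ring.
- exfalso; move: kt; rewrite mulr0 => /esym/eqP.
  by rewrite mulf_eq0 sqrf_eq0 (negPf yN0) sub0r oppr_eq0 pnatr_eq0.
- by exfalso; suff : (2 %| 1)%Z by []; apply: (odd_y _ y) => //; rewrite yE; ring.
- by exfalso; move/eqP: yE; rewrite subrr mulf_eq0 (negPf two0) (negPf yN0).
- have y1 : y = 1 by apply: (mulfI two0); rewrite yE; ring.
  exfalso; suff : (4 %| -1)%Z by [].
  apply: (@Aint_dvdz (k ^+ 2)) => //; rewrite mulrC.
  by transitivity (k ^+ 2 * 4) => //; rewrite kt y1; ring.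
- by exfalso; suff : (2 %| -1)%Z by []; apply: (odd_y _ y) => //; rewrite yE; ring.
- have y1 : y = 1 - e by apply: (mulfI two0); rewrite yE; ring.
  have tN0 : 4 - 2 * e != 0.
    apply/eqP => h; have /eqP : (4 - 2 * e) * (4 + 2 * e) = 20 by ring: e2.
    by rewrite h mul0r eq_sym pnatr_eq0.
  have : k ^+ 2 == e ^+ 2.
    by apply/eqP; apply: (mulIf tN0); rewrite kt y1; ring: e2.
  rewrite eqf_sqr => /orP[] /eqP ->.
  + have -> : (y - e, y, y + e) = (2 * - e + 1, - e + 1, 1).
      by rewrite y1; congr (_, _, _); ring.
    by rewrite mem_cat /signed_triples2 mem_head orbT.
  + have -> : (y - - e, y, y + - e) = (1, - e + 1, 2 * - e + 1).
      by rewrite y1; congr (_, _, _); ring.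
    by rewrite mem_cat orbC !inE eqxx orbT.
(* For t = 1 - 2e, the algebraic integer [y + e] would have double -1. *)
- exfalso; suff : (2 %| -1)%Z by [].
  by apply: (odd_y _ (y + e)); [apply: rpredD|rewrite mulrDr yE; ring].
Qed.

(** * The listed triples are solutions *)

Lemma AP_quad0 (D : int) (d : nat) : AP_quad D d (0, 0, 0).
Proof.
have q0 : quad_int_ring D 0 by apply: quad_int_int; apply: rpred0.
by split=> //; ring.
Qed.

Ltac quad_int_closed :=
  repeat first [ assumption | apply: quad_intM | apply: quad_intD
               | apply: quad_intN ].

(** The equation holds modulo e^2 = -1, so one computation serves both 'i and its opposite. *)
Lemma AP_quad_signed1 (e : algC) (t : algC * algC * algC) :
  e ^+ 2 = -1 -> quad_int_ring (-1) e -> t \in signed_triples1 e -> AP_quad (-1) 1 t.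
Proof.
move=> e2 eq.
have natq m : quad_int_ring (-1) m%:R by apply: quad_int_int; apply: rpred_nat.
have q1 := natq 1%N; have q2 := natq 2%N; have q3 := natq 3%N; have q4 := natq 4%N.
rewrite !inE; repeat case/orP; move=> /eqP ->;
  (split; [quad_int_closed|quad_int_closed|quad_int_closed|ring|ring: e2]).
Qed.

Lemma AP_quad_signed2 (e : algC) (t : algC * algC * algC) :
  e ^+ 2 = -1 -> quad_int_ring (-1) e -> t \in signed_triples2 e -> AP_quad (-1) 2 t.
Proof.
move=> e2 eq.
have natq m : quad_int_ring (-1) m%:R by apply: quad_int_int; apply: rpred_nat.
have q1 := natq 1%N; have q2 := natq 2%N.
rewrite !inE; repeat case/orP; move=> /eqP ->;
  (split; [quad_int_closed|quad_int_closed|quad_int_closed|ring|ring: e2]).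
Qed.

Lemma AP_quad_rational1 (t : algC * algC * algC) :
  t \in [:: (3, 3, 3); (- 15, - 6, 3); (3, - 6, - 15)] -> AP_quad (-1) 1 t.
Proof.
have natq m : quad_int_ring (-1) m%:R by apply: quad_int_int; apply: rpred_nat.
have q3 := natq 3%N; have q6 := natq 6%N; have q15 := natq 15%N.
rewrite !inE; repeat case/orP; move=> /eqP ->;
  (split; [quad_int_closed|quad_int_closed|quad_int_closed|ring|ring]).
Qed.

(** * Assembling the classification *)

Lemma AP_quad_gauss1 (t : algC * algC * algC) : AP_quad (-1) 1 t <-> t \in triples1.
Proof.
have iq := quad_int_i; have i2 := sqrCi algC.
have Niq := quad_intN _ _ iq; have Ni2 : (- 'i) ^+ 2 = -1 :> algC by rewrite sqrrN.
rewrite /triples1 2!mem_cat in_cons -orbA; split.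
  case: t => [[x y] z] /AP_sol_diff[k [-> -> yq ykq eqn]].
  have kq := quad_int_diff _ _ _ yq ykq.
  have [y0|yN0] := eqVneq y 0.
    by rewrite (AP_diff0 _ _ _ eqn y0) y0 subr0 addr0 eqxx.
  (* If [e] is [- 'i], the two signed families merely trade places. *)
  have [e /sqrtN1_cases[]->] := gauss_AP1 _ _ yq kq yN0 eqn; rewrite ?opprK !mem_cat;
    by case/or3P=> ->; rewrite ?orbT.
case/or4P=> [/eqP ->|||]; first exact: AP_quad0.
- exact: AP_quad_rational1.
- exact: AP_quad_signed1.
- exact: AP_quad_signed1.
Qed.

Lemma AP_quad_gauss2 (t : algC * algC * algC) : AP_quad (-1) 2 t <-> t \in triples2.
Proof.
have iq := quad_int_i; have i2 := sqrCi algC.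
have Niq := quad_intN _ _ iq; have Ni2 : (- 'i) ^+ 2 = -1 :> algC by rewrite sqrrN.
rewrite /triples2 in_cons mem_cat; split.
  case: t => [[x y] z] /AP_sol_diff[k [-> -> yq ykq eqn]].
  have kq := quad_int_diff _ _ _ yq ykq.
  have [y0|yN0] := eqVneq y 0.
    by rewrite (AP_diff0 _ _ _ eqn y0) y0 subr0 addr0 eqxx.
  have [e /sqrtN1_cases[]->] := gauss_AP2 _ _ yq kq yN0 eqn; rewrite ?opprK !mem_cat;
    by case/orP=> ->; rewrite ?orbT.
case/or3P=> [/eqP ->||]; first exact: AP_quad0.
- exact: AP_quad_signed2.
- exact: AP_quad_signed2.
Qed.

Theorem theorem4 :
  [/\ forall t : algC * algC * algC, AP_quad (-1) 1 t <-> t \in triples1,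
      forall t : algC * algC * algC, AP_quad (-1) 2 t <-> t \in triples2
    & forall (D : int) (d : nat),
        squarefreez D -> D < 0 -> (0 < d)%N ->
        (D, d) <> (-1, 1%N) -> (D, d) <> (-1, 2%N) ->
        forall t : algC * algC * algC, AP_quad D d t <-> AP_rat d t].
Proof.
split; [exact: AP_quad_gauss1|exact: AP_quad_gauss2|].
move=> D d sqfD D0 d0 ND1 ND2 [[x y] z]; split; last first.
  by case=> hx hy hz xyz eqn; split => //; apply: quad_int_int.
move=> sol; have [_ _ _ xyz eqn'] := sol.
have [k [xE zE yq ykq eqn]] := AP_sol_diff _ _ _ _ _ sol.
have kq := quad_int_diff _ _ _ yq ykq.
have [[hy hk]|[DN1 d2]] := AP_rat_or_gauss _ _ _ _ sqfD D0 d0 yq kq eqn.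
  by split => //; rewrite ?xE ?zE ?rpredB ?rpredD.
(* With D = -1 and d equal to 1 or 2, only the excluded pairs remain. *)
by exfalso; case: d d0 d2 ND1 ND2 {sol eqn eqn'} => [|[|[|d]]] // _ _; rewrite DN1.
Qed.
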